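(* Let $P$ be a binary matrix with rows $\mathbf{p}\in\mathbb{F}_2^n$, let $\mathbf{H}_P=\sum_{\mathbf{p}}\frac{\pi}{8}\prod_{j:p_j=1}X_j$, let $\mathbf{X}$ satisfy $\Pr(\mathbf{X}=\mathbf{x})=|\langle\mathbf{x}|\exp(i\mathbf{H}_P)|\mathbf{0}\rangle|^2$, and let $\mathbf{Y}$ satisfy $\Pr(\mathbf{Y}=\mathbf{y})=\Pr_{\mathbf{d},\mathbf{e}}\bigl(\sum_{\mathbf{p}\in P_{\mathbf{d}}\cap P_{\mathbf{e}}}\mathbf{p}=\mathbf{y}\bigr)$ with $\mathbf{d},\mathbf{e}$ uniform and independent on $\mathbb{F}_2^n$, where $P_{\mathbf{d}}$ is the set of rows with $\mathbf{p}\cdot\mathbf{d}^T=1$. Then for every $\mathbf{s}\in\mathbb{F}_2^n$, $\Pr(\mathbf{X}\cdot\mathbf{s}^T=0)=1$ implies $\Pr(\mathbf{Y}\cdot\mathbf{s}^T=0)=1$.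
   Context: $X_j$ is Pauli $X$ on qubit $j$ of $n$ qubits; inner products are over $\mathbb{F}_2$. *)

(* Defs.v *)
From HB Require Import structures.
From mathcomp Require Import all_boot all_order all_algebra.
From mathcomp Require Import complex.
From mathcomp Require Import all_classical all_reals all_analysis.

Set Implicit Arguments.
Unset Strict Implicit.
Unset Printing Implicit Defensive.

Import Order.TTheory GRing.Theory Num.Theory.
Import numFieldNormedType.Exports.

Local Open Scope ring_scope.

(* An alias of 'rV['F_2]_n, so that it can carry the discrete sigma-algebra. *)
Definition bits (n : nat) : Type := 'rV['F_2]_n.

HB.instance Definition _ (n : nat) := Finite.on (bits n).
HB.instance Definition _ (n : nat) := GRing.Zmodule.on (bits n).
HB.instance Definition _ (n : nat) := isPointed.Build (bits n) 0.
HB.instance Definition _ (n : nat) :=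
  @isMeasurable.Build default_measure_display (bits n)
    discrete_measurable discrete_measurable0
    discrete_measurableC discrete_measurableU.

Definition dot (n : nat) (u v : bits n) : 'F_2 :=
  ((u : 'rV['F_2]_n) *m (v : 'rV['F_2]_n)^T) 0 0.

(* The series converges in the sup norm of 'M[K]_N when K is complete, e.g. for
   K := R[i]; N may be 0. *)
Definition expmx (K : numFieldType) (N : nat) (A : 'M[K]_N) : 'M[K]_N :=
  limn (series (fun k : nat => (k`!%:R)^-1 *: (A ^+ k))).

Section Qubits.
Variables (R : realType) (n : nat).

(* Operators on n qubits are matrices in the computational basis, whose vectors
   |x>, x in F_2^n, are numbered by enum_rank. *)
Definition ket (x : bits n) : 'cV[R[i]]_#|{: bits n}| := delta_mx (enum_rank x) 0.

Definition bra (x : bits n) : 'rV[R[i]]_#|{: bits n}| :=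
  map_mx Num.conj (ket x)^T.

Definition tensor_op (A : 'I_n -> 'M[R[i]]_2) : 'M[R[i]]_#|{: bits n}| :=
  \matrix_(a, b) \prod_(k < n)
    A k ((enum_val a : 'rV['F_2]_n) 0 k) ((enum_val b : 'rV['F_2]_n) 0 k).

Definition sigma_x : 'M[R[i]]_2 := \matrix_(a, b) (a != b)%:R.

Definition pauliX (j : 'I_n) : 'M[R[i]]_#|{: bits n}| :=
  tensor_op (fun k => if k == j then sigma_x else 1%:M).

Variables (m : nat) (P : 'M['F_2]_(m, n)).

(* Repeated rows of P are counted with multiplicity. *)
Definition hamiltonian : 'M[R[i]]_#|{: bits n}| :=
  \sum_(i < m) (pi / 8)%:C%C *: \prod_(j < n | P i j == 1) pauliX j.

Definition amplitude (x : bits n) : R[i] :=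
  (bra x *m expmx ('i%C *: hamiltonian) *m ket 0) 0 0.

Definition probX (x : bits n) : R := ComplexField.Normc.normc (amplitude x) ^+ 2.

(* P_d, as a set of row indices. *)
Definition selected_rows (d : bits n) : {set 'I_m} :=
  [set i | dot (row i P) d == 1].

Definition rows_sum (d e : bits n) : bits n :=
  \sum_(i in selected_rows d :&: selected_rows e) row i P.

Definition unif_mass (d : bits n) : R := (#|{: bits n}|%:R)^-1.

(* The joint mass of independent d and e is the product of their masses. *)
Definition probY (y : bits n) : R :=
  \sum_(de : bits n * bits n | rows_sum de.1 de.2 == y)
    unif_mass de.1 * unif_mass de.2.

End Qubits.

(* Main.v *)
Require Import Defs.
From HB Require Import structures.
From mathcomp Require Import all_boot all_order all_algebra.
From mathcomp Require Import complex ring.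
From mathcomp Require Import all_classical all_reals all_analysis.

Set Implicit Arguments.
Unset Strict Implicit.
Unset Printing Implicit Defensive.

Import Order.TTheory GRing.Theory Num.Theory.
Import numFieldNormedType.Exports.

Local Open Scope classical_set_scope.
Local Open Scope ring_scope.

(* The Walsh characters chi(u, .) are eigenvectors of every product of Pauli X's,
   so exp(iH)|0> has Walsh transform exp(i E(u)), where
   E(u) = pi/8 \sum_p (-1)^(p.u). If Pr(X.s = 0) = 1, the amplitudes vanish off
   the hyperplane x.s = 0, hence exp(iE) is invariant under translation by s.
   Now E(u) - E(u + s) = pi/4 b(u) with b(u) = \sum_(p in P_s) (-1)^(p.u), so
   8 divides every b(u). Since
   4 |P_s :&: P_d :&: P_e| = b(0) - b(d) - b(e) + b(d + e),
   this triple intersection is even; its parity is (\sum_(p in P_d :&: P_e) p).s. *)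

(** * Signs of elements of F_2 *)

Lemma F2_eq1 (x : 'F_2) : (x == 1) = (x != 0).
Proof. by case: x => [[|[|x]] ltx]. Qed.

Definition signF2 (K : pzRingType) (x : 'F_2) : K := (-1) ^+ (x == 1).

Lemma signF2D (K : pzRingType) (x y : 'F_2) :
  signF2 K (x + y) = signF2 K x * signF2 K y.
Proof.
rewrite /signF2 -exprD -[RHS]signr_odd oddD !oddb.
by congr (_ ^+ _); case: x => [[|[|x]] ltx]; case: y => [[|[|y]] lty].
Qed.

Lemma signF2_0 (K : pzRingType) : signF2 K 0 = 1.
Proof. by []. Qed.

Lemma signF2_1 (K : pzRingType) : signF2 K 1 = -1.
Proof. by []. Qed.

Lemma rmorph_signF2 (K L : pzRingType) (f : {rmorphism K -> L}) (x : 'F_2) :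
  f (signF2 K x) = signF2 L x.
Proof. by rewrite /signF2 rmorphXn rmorphN1. Qed.

(** * The bilinear form on F_2^n *)

Section Dot.
Variable n : nat.
Implicit Types u v w : bits n.

Lemma dotE u v :
  dot u v = \sum_j (u : 'rV['F_2]_n) 0 j * (v : 'rV['F_2]_n) 0 j.
Proof. by rewrite /dot mxE; apply: eq_bigr => j _; rewrite mxE. Qed.

Lemma dotC u v : dot u v = dot v u.
Proof. by rewrite !dotE; apply: eq_bigr => j _; rewrite mulrC. Qed.

Lemma dotDl u v w : dot (u + v) w = dot u w + dot v w.
Proof.
by rewrite !dotE -big_split; apply: eq_bigr => j _ /=; rewrite mxE mulrDl.
Qed.

Lemma dotDr u v w : dot w (u + v) = dot w u + dot w v.
Proof. by rewrite ![dot w _]dotC dotDl. Qed.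

Lemma dot0l v : dot 0 v = 0.
Proof. by rewrite dotE big1// => j _; rewrite mxE mul0r. Qed.

Lemma dot0r v : dot v 0 = 0.
Proof. by rewrite dotC dot0l. Qed.

Lemma dot_suml (I : finType) (Q : pred I) (F : I -> bits n) v :
  dot (\sum_(i | Q i) F i) v = \sum_(i | Q i) dot (F i) v.
Proof.
by apply: (big_morph (fun u => dot u v)) => [u w|]; rewrite ?dotDl ?dot0l.
Qed.

Definition unit_bits (j : 'I_n) : bits n := delta_mx 0 j.

Lemma dot_unit_bits (j : 'I_n) v : dot (unit_bits j) v = (v : 'rV['F_2]_n) 0 j.
Proof.
rewrite dotE (bigD1 j)//= big1 => [|k neq_kj]; rewrite !mxE !eqxx /=.
  by rewrite mul1r addr0.
by rewrite (negPf neq_kj) mul0r.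
Qed.

Lemma bits_addKr u : u + u = 0.
Proof.
by apply/rowP => j; rewrite !mxE; case: (_ 0 j) => [[|[|x]] ltx]//; apply/val_inj.
Qed.

End Dot.

(** * Walsh characters of F_2^n and their orthogonality *)

Section Character.
Variables (K : numDomainType) (n : nat).
Implicit Types u v w : bits n.

Definition chi u v : K := signF2 K (dot u v).

Lemma chiC u v : chi u v = chi v u.
Proof. by rewrite /chi dotC. Qed.

Lemma chiDl u v w : chi (u + v) w = chi u w * chi v w.
Proof. by rewrite /chi dotDl signF2D. Qed.

Lemma chiDr u v w : chi w (u + v) = chi w u * chi w v.
Proof. by rewrite /chi dotDr signF2D. Qed.

Lemma chi0r v : chi v 0 = 1.
Proof. by rewrite /chi dot0r. Qed.

Lemma sum_chi v : \sum_u chi u v = #|{: bits n}|%:R *+ (v == 0).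
Proof.
have [->|v_neq0] := eqVneq v 0.
  by under eq_bigr do rewrite chi0r; rewrite sumr_const.
have [j vj] : exists j, (v : 'rV['F_2]_n) 0 j = 1.
  apply/exists_eqP; apply: contraNT v_neq0; rewrite negb_exists => /forallP v0.
  by apply/eqP/rowP => j; have := v0 j; rewrite F2_eq1 negbK mxE => /eqP.
(* Translating [u] by [unit_bits j], at a position where [v] has entry 1, flips every sign: the sum
   equals its opposite, hence is 0. *)
apply/eqP; rewrite mulr0n -eqNr -sumrN.
rewrite [eqbRHS](reindex_inj (addIr (unit_bits j)))/=; apply/eqP/eq_bigr => u _.
by rewrite chiDl {3}/chi dot_unit_bits vj signF2_1 mulrN1.
Qed.

(** The unnormalised n-qubit Hadamard matrix, indexed like the kets. *)
Definition walsh_mx : 'M[K]_#|{: bits n}| :=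
  \matrix_(a, b) chi (enum_val a) (enum_val b).

Lemma walsh_mxK : walsh_mx *m walsh_mx = #|{: bits n}|%:R%:M.
Proof.
apply/matrixP => a b; rewrite !mxE.
transitivity (\sum_u chi u (enum_val a + enum_val b)).
  rewrite [RHS](reindex (@enum_val _ {: bits n}))/=; last first.
    by exists enum_rank => u _; rewrite ?enum_valK ?enum_rankK.
  by apply: eq_bigr => c _; rewrite !mxE chiC chiDr.
rewrite sum_chi; congr (_ *+ _); congr nat_of_bool.
by rewrite -(inj_eq (addIr (enum_val b))) add0r -addrA bits_addKr addr0
           (inj_eq enum_val_inj).
Qed.

End Character.

(** * Exponential of a diagonalized matrix *)

Lemma cvg_mx (K : numFieldType) (p q : nat) (u : nat -> 'M[K]_(p, q))
    (L : 'M[K]_(p, q)) :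
  (forall i j, (fun k => u k i j) @ \oo --> L i j) -> u @ \oo --> L.
Proof.
move=> cvgu; apply/cvg_ballP => e e_gt0.
have : \forall k \near \oo, forall ij : 'I_p * 'I_q,
    ball (L ij.1 ij.2) e (u k ij.1 ij.2).
  by apply: filter_forall => -[i j]; apply: (cvgu i j); exact: nbhsx_ballx.
by apply: filterS => k uk; split=> // i j; exact: (uk (i, j)).
Qed.

Lemma mulmx_diag_expr (K : comPzRingType) (N : nat) (V W : 'M[K]_N)
    (d : 'rV[K]_N) (k : nat) :
  V *m W = 1%:M -> W *m V = 1%:M ->
  (V *m diag_mx d *m W) ^+ k = V *m diag_mx (map_mx (fun x => x ^+ k) d) *m W.
Proof.
move=> VW WV; elim: k => [|k IHk].
  suff -> : map_mx (fun x => x ^+ 0) d = const_mx 1.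
    by rewrite diag_const_mx mulmx1 VW.
  by apply/rowP => j; rewrite !mxE.
rewrite exprS IHk -mulmxE !mulmxA -(mulmxA _ W V) WV mulmx1.
rewrite -(mulmxA V) mulmx_diag; congr (V *m diag_mx _ *m W).
by apply/rowP => j; rewrite !mxE exprS.
Qed.

(** Each entry of a partial sum is a fixed linear combination of the scalar partial sums at the
    eigenvalues [d]. The scalar limits [f] are given as data because [K] may be incomplete. *)
Lemma expmx_diagonalized (K : numFieldType) (N : nat) (V W : 'M[K]_N)
    (d f : 'rV[K]_N) :
  V *m W = 1%:M -> W *m V = 1%:M ->
  (forall j, series (fun k => (k`!%:R)^-1 * d 0 j ^+ k) @ \oo --> f 0 j) ->
  expmx (V *m diag_mx d *m W) = V *m diag_mx f *m W.
Proof.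
move=> VW WV cvgf; apply: cvg_lim; first exact: norm_hausdorff.
have mxE3 (g : 'rV[K]_N) i j :
    (V *m diag_mx g *m W) i j = \sum_l V i l * W l j * g 0 l.
  rewrite mxE; apply: eq_bigr => l _; rewrite mul_mx_diag mxE.
  by rewrite mulrAC.
apply: cvg_mx => i j; rewrite mxE3.
rewrite (_ : (fun _ => _) = fun k => \sum_l V i l * W l j *
  series (fun k => (k`!%:R)^-1 * d 0 l ^+ k) k); last first.
  apply/funext => k; rewrite /series /= summxE.
  under [RHS]eq_bigr do rewrite mulr_sumr.
  rewrite exchange_big; apply: eq_bigr => r _; rewrite mxE mulmx_diag_expr//.
  rewrite mxE3 mulr_sumr; apply: eq_bigr => l _.
  by rewrite mxE mulrCA.
apply: cvg_big => [|l _]; first exact: add_continuous.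
by apply: cvgMr; exact: cvgf.
Qed.

(** * Euler's formula, and the multiples of pi/4 with cosine 1 *)

Lemma cvg_complex (R : realType) (u v : nat -> R) (a b : R) :
  u @ \oo --> a -> v @ \oo --> b ->
  ((fun k => (u k +i* v k)%C) : nat -> (R[i] : numFieldType)) @ \oo -->
    ((a +i* b)%C : (R[i] : numFieldType)).
Proof.
move=> /cvgrPdist_lt cvgu /cvgrPdist_lt cvgv.
apply/cvgrPdist_lt => -[e e'] /=; rewrite ltcE /= => /andP[/eqP-> e_gt0].
have e2 : 0 < e / 2 by rewrite divr_gt0.
near=> k.
have -> : (a +i* b - (u k +i* v k) = (a - u k)%:C + 'i * (b - v k)%:C)%C.
  by simpc.
apply: le_lt_trans (ler_normD _ _) _.
rewrite normrM !normc_def /= !expr0n /= !(addr0, add0r) expr1n sqrtr1 mul1r.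
rewrite !sqrtr_sqr -rmorphD /= ltcR [ltRHS]splitr ltrD//; near: k.
  exact: cvgu.
exact: cvgv.
Unshelve. all: by end_near.
Qed.

(** Since i^k is (-1)^(k./2), times i for odd k, the partial sums split exactly into those of the
    cosine and sine series. *)
Lemma cvg_expi (R : realType) (x : R) :
  (series (fun k => (k`!%:R)^-1 * ('i * x%:C) ^+ k)%C : nat -> (R[i] : numFieldType))
    @ \oo --> ((cos x +i* sin x)%C : (R[i] : numFieldType)).
Proof.
rewrite (_ : series _ =
    fun k => (series (cos_coeff x) k +i* series (sin_coeff x) k)%C); last first.
  apply/funext => k; rewrite /series /=; elim: k => [|k IHk].
    by rewrite !big_geq.
  rewrite !big_nat_recr//= IHk.
  rewrite -[RHS]/((_ +i* _)%C + (cos_coeff x k +i* sin_coeff x k)%C); congr (_ + _).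
  rewrite cos_coeffE sin_coeffE exprMn -rmorphXn.
  have -> : ('i : R[i])%C ^+ k = ((-1) ^+ k./2)%:C%C * (if odd k then 'i%C else 1).
    rewrite -{1}(odd_double_half k) exprD -mul2n exprM sqr_i rmorphXn rmorphN1.
    by rewrite mulrC; case: odd; rewrite ?expr1.
  have -> : (k`!%:R)^-1 = ((k`!%:R)^-1 : R)%:C%C.
    by rewrite fmorphV rmorph_nat.
  (* The sine coefficients use [k.-1./2], which agrees with [k./2] for odd [k]; for even [k] both
     sides are 0. *)
  have -> : (odd k)%:R * (-1) ^+ k.-1./2 = (odd k)%:R * (-1) ^+ k./2 :> R.
    case: k {IHk} => //= k; rewrite uphalf_half.
    by case: odd; rewrite ?mul0r.
  move: (k`!%:R^-1) ((-1) ^+ k./2) (x ^+ k) => c s y.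
  case: (odd k) => /=; simpc; congr (_ +i* _)%C; ring.
have cvg_cos : series (cos_coeff x) @ \oo --> cos x.
  by rewrite cos.unlock; exact: is_cvg_series_cos_coeff.
have cvg_sin : series (sin_coeff x) @ \oo --> sin x.
  by rewrite sin.unlock; exact: is_cvg_series_sin_coeff.
exact: (cvg_complex cvg_cos cvg_sin).
Qed.

(** The cosine is even and its period is 8 steps of pi/4, so only r = |z| mod 8 matters. For r <= 4
    the angle lies in [0, pi], where cos is injective; for r > 4 the reflected residue 8 - r has the
    same cosine. *)
Lemma cos_piquarter_eq1 (R : realType) (z : int) :
  cos (pi / 4 * z%:~R : R) = 1 -> (8 %| z)%Z.
Proof.
suff cosn (k : nat) : cos (pi / 4 * k%:R : R) = 1 -> (8 %| k)%N.
  rewrite -cos_norm normrM ger0_norm ?divr_ge0 ?pi_ge0// -intr_norm.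
  by rewrite -abszE -pmulrn => /cosn; rewrite dvdzE.
rewrite {1}(divn_eq k 8) natrD natrM.
have -> : pi / 4 * ((k %/ 8)%:R * 8%:R + (k %% 8)%:R) =
    pi / 4 * (k %% 8)%:R + (pi *+ 2) *+ (k %/ 8) :> R.
  by rewrite -mulr_natr; field.
rewrite (periodicn (@cosD2pi R)) => cos1.
have cos_small (r : nat) : (r <= 4)%N -> cos (pi / 4 * r%:R : R) = 1 -> r = 0%N.
  move=> le_r4 cosr; have /eqP : pi / 4 * r%:R = 0 :> R.
    apply: cos_inj; rewrite ?cos0// in_itv /= ?lexx ?pi_ge0//.
    rewrite mulr_ge0 ?divr_ge0 ?pi_ge0//= -mulrA ler_piMr ?pi_ge0//.
    by rewrite mulrC ler_pdivrMr// mul1r ler_nat.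
  by rewrite !mulf_eq0 invr_eq0 !pnatr_eq0 (gt_eqF (pi_gt0 R))/= => /eqP.
have lt_r8 : (k %% 8 < 8)%N by rewrite ltn_mod.
have [le_r4|lt_4r] := leqP (k %% 8) 4; first by apply/eqP/cos_small.
suff : (8 - k %% 8 = 0)%N.
  by move/eqP; rewrite subn_eq0 leqNgt lt_r8.
apply: cos_small; first by rewrite leq_subLR (leq_add2r 4 4) ltnW.
rewrite -[RHS]cos1 natrB ?(ltnW lt_r8)// -[RHS]cosN -[RHS]cosD2pi.
by congr cos; rewrite -mulr_natr; field.
Qed.

(** * Spectrum of the Hamiltonian *)

Section Walsh.
Variables (R : realType) (n : nat).
Local Notation K := (R[i]).
Local Notation H := (walsh_mx K n).

Lemma pauliXE (j : 'I_n) (a b : 'I_#|{: bits n}|) :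
  pauliX R j a b = (enum_val b == enum_val a + unit_bits j :> bits n)%:R.
Proof.
rewrite mxE; set u := enum_val a; set v := enum_val b.
case: eqP => [->|/eqP neq_v].
  rewrite big1// => k _; rewrite !mxE eqxx /=.
  case: eqVneq => [->|neq_kj]; last by rewrite addr0 mxE eqxx.
  by rewrite mxE; case: (_ 0 j) => [[|[|x]] ltx].
apply/eqP/prodf_eq0.
have [k neq_k] : exists k, (v : 'rV_n) 0 k != (u + unit_bits j : 'rV_n) 0 k.
  apply/existsP; apply: contraNT neq_v; rewrite negb_exists => /forallP eq_k.
  by apply/eqP/rowP => k; have := eq_k k; rewrite negbK => /eqP.
exists k => //.
move: neq_k; rewrite !mxE eqxx /=; case: (eqVneq k j) => [->|neq_kj].
  rewrite mxE; case: (_ 0 j) => [[|[|x]] ltx]//; case: (_ 0 j) => [[|[|y]] lty]//.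
by rewrite addr0 mxE eq_sym => /negPf ->.
Qed.

(** [pauliX j] translates F_2^n by [unit_bits j], and a character turns a translation into a scalar
    factor. *)
Lemma pauliX_walsh (j : 'I_n) (a : 'I_#|{: bits n}|) :
  pauliX R j *m col a H = chi K (unit_bits j) (enum_val a) *: col a H.
Proof.
apply/colP => b; rewrite !mxE.
rewrite (bigD1 (enum_rank (enum_val b + unit_bits j)))//= big1 => [|c neq_c].
  by rewrite pauliXE !mxE enum_rankK eqxx mul1r addr0 chiDl mulrC.
rewrite pauliXE -(inj_eq enum_rank_inj) enum_valK (negPf neq_c) mul0r//.
Qed.

Variables (m : nat) (P : 'M['F_2]_(m, n)).

Definition energy (u : bits n) : R := \sum_i pi / 8 * chi R (row i P) u.

Lemma hamiltonian_walsh (a : 'I_#|{: bits n}|) :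
  hamiltonian R P *m col a H = (energy (enum_val a))%:C%C *: col a H.
Proof.
rewrite /hamiltonian /energy mulmx_suml rmorph_sum scaler_suml.
apply: eq_bigr => i _; rewrite -scalemxAl [in RHS]rmorphM -scalerA /=.
congr (_ *: _).
(* The character of a row factors over the support of that row into the eigenvalues of the
   corresponding [pauliX j]. *)
have -> : (chi R (row i P) (enum_val a))%:C%C =
    \prod_(j < n | P i j == 1) chi K (unit_bits j) (enum_val a).
  rewrite /chi rmorph_signF2 dotE.
  rewrite (bigID (fun j => P i j == 1))/= [X in _ + X]big1 => [|j]; last first.
    by rewrite F2_eq1 negbK mxE => /eqP ->; rewrite mul0r.
  rewrite addr0 (big_morph _ (@signF2D K) (signF2_0 K)).
  by apply: eq_bigr => j /eqP Pij; rewrite mxE Pij mul1r dot_unit_bits.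
apply: (big_rec2 (fun A c => A *m col a H = c *: col a H)) => [|j c A _ IH].
  by rewrite mul1mx scale1r.
by rewrite -mulmxA IH -scalemxAr pauliX_walsh scalerA mulrC.
Qed.

(** exp(i E(u)) as a pair of reals, so that equal phases give equal cosines and equal sines. *)
Definition phase (u : bits n) : K := (cos (energy u) +i* sin (energy u))%C.

Local Notation N := (#|{: bits n}|%:R : K).

Lemma card_bits_neq0 : N != 0.
Proof. by rewrite pnatr_eq0 -lt0n; apply/card_gt0P; exists 0. Qed.

Lemma walsh_mxV : H *m (N^-1 *: H) = 1%:M.
Proof. by rewrite -scalemxAr walsh_mxK scale_scalar_mx mulVf// card_bits_neq0. Qed.

Lemma expmx_hamiltonian :
  expmx ('i%C *: hamiltonian R P) =
  H *m diag_mx (\row_a phase (enum_val a)) *m (N^-1 *: H).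
Proof.
have VH : N^-1 *: H *m H = 1%:M by rewrite -scalemxAl scalemxAr walsh_mxV.
have cvg_phase (a : 'I_#|{: bits n}|) :
    series (fun k => (k`!%:R)^-1 *
      (\row_b ('i * (energy (enum_val b))%:C)%C : 'rV[K]__) 0 a ^+ k) @ \oo -->
    ((\row_b phase (enum_val b) : 'rV[K]__) 0 a : (K : numFieldType)).
  by rewrite !mxE; exact: cvg_expi.
rewrite -(expmx_diagonalized walsh_mxV VH cvg_phase).
congr expmx.
(* Inserting [H] times its inverse on the right leaves the eigenvector equation, read entry by
   entry. *)
rewrite -[LHS]mulmx1 -walsh_mxV mulmxA; congr (_ *m _).
apply/matrixP => b a; rewrite -scalemxAl mul_mx_diag [LHS]mxE.
have -> : (hamiltonian R P *m H) b a = (hamiltonian R P *m col a H) b 0.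
  by rewrite !mxE; apply: eq_bigr => c _; rewrite [col _ _ _ _]mxE.
by rewrite hamiltonian_walsh !mxE mulrA mulrC.
Qed.

(** * Walsh transform of the amplitudes and divisibility of the biases *)

Lemma sum_chi_amplitude (u : bits n) :
  \sum_x chi K u x * amplitude R P x = phase u.
Proof.
have amplitudeE x :
    amplitude R P x = (expmx ('i%C *: hamiltonian R P) *m ket R 0) (enum_rank x) 0.
  rewrite /amplitude -mulmxA.
  have -> : bra R x = delta_mx 0 (enum_rank x).
    by apply/rowP => b; rewrite !mxE rmorph_nat andbC.
  by rewrite -rowE mxE.
transitivity ((H *m (expmx ('i%C *: hamiltonian R P) *m ket R 0)) (enum_rank u) 0).
  rewrite mxE (reindex (@enum_rank {: bits n}))/=; last first.
    by exists enum_val => x _; rewrite ?enum_valK ?enum_rankK.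
  by apply: eq_bigr => x _; rewrite amplitudeE [H _ _]mxE !enum_rankK.
(* The outer [H] cancels the diagonalizing one up to [N], and [H] sends |0> to the all-ones vector,
   so only the diagonal entry at [u] is left. *)
rewrite expmx_hamiltonian !mulmxA walsh_mxK -!mulmxA mul_scalar_mx.
rewrite -scalemxAl -scalemxAr scalerA.
rewrite mulfV ?card_bits_neq0// scale1r mul_diag_mx mxE /ket -colE.
by rewrite !mxE !enum_rankK chi0r mulr1.
Qed.

(** Only the [x] with x.s = 0 contribute to the transform, and there the factor [chi s x] gained by
    the translation is 1. *)
Lemma phase_translate (s : bits n) :
  (forall x, dot x s != 0 -> amplitude R P x = 0) ->
  forall u, phase (u + s) = phase u.
Proof.
move=> amp0 u; rewrite -!sum_chi_amplitude; apply: eq_bigr => x _.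
have [xs0|/amp0->] := eqVneq (dot x s) 0; last by rewrite !mulr0.
by rewrite chiDl [chi _ s x]chiC {2}/chi xs0 signF2_0 mulr1.
Qed.

(** Counts the rows of P_s with p.u = 0 minus those with p.u = 1; integer-valued, so that
    divisibility by 8 makes sense. *)
Definition bias (s u : bits n) : int :=
  \sum_(i in selected_rows P s) chi int (row i P) u.

(** Rows outside P_s cancel; a row of P_s changes sign under the translation, so it counts twice,
    and 2 pi/8 = pi/4. *)
Lemma energy_translate (s u : bits n) :
  energy u - energy (u + s) = pi / 4 * (bias s u)%:~R.
Proof.
rewrite /energy /bias -sumrB rmorph_sum mulr_sumr [RHS]big_mkcond.
apply: eq_bigr => i _; rewrite chiDr rmorph_signF2 -/(chi _ _ _) inE.
by rewrite {3}/chi /signF2; case: eqP => _; rewrite ?expr1 ?expr0; field.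
Qed.

Lemma dvdz_bias (s : bits n) :
  (forall x, dot x s != 0 -> amplitude R P x = 0) ->
  forall u, (8 %| bias s u)%Z.
Proof.
move=> /phase_translate phaseD u; apply: (@cos_piquarter_eq1 R).
(* Equal phases turn the cosine of the energy difference into cos^2 + sin^2 = 1. *)
rewrite -energy_translate cosB; have [-> ->] := phaseD u.
by rewrite -!expr2 cos2Dsin2.
Qed.

(* 4 [p.d = 1] [p.e = 1] = (1 - chi p d) (1 - chi p e), summed over P_s. *)
Lemma card_selected_rows3 (s d e : bits n) :
  (4 * #|selected_rows P s :&: (selected_rows P d :&: selected_rows P e)|)%:Z =
  bias s 0 - bias s d - bias s e + bias s (d + e).
Proof.
rewrite /bias -!sumrB -big_split /=.
rewrite PoszM -[Posz #|_|]natz -sum1_card natr_sum mulr_sumr.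
rewrite (eq_bigl _ _ (fun i => finset.in_setI i _ _)) big_mkcondr.
apply: eq_bigr => i _; rewrite chi0r chiDr /chi /signF2 !inE.
by do 2![case: eqP => _].
Qed.

Lemma dot_rows_sum (s d e : bits n) :
  (forall x, dot x s != 0 -> amplitude R P x = 0) ->
  dot (rows_sum P d e) s = 0.
Proof.
move=> /dvdz_bias dvd8.
have even3 :
    (2 %| #|selected_rows P s :&: (selected_rows P d :&: selected_rows P e)|)%N.
  (* All four biases are multiples of 8, hence so is 4 times the cardinality; cancelling 4 leaves a
     factor 2. *)
  rewrite -(@dvdn_pmul2l 4)//; have : (8 %| (4 * #|selected_rows P s :&:
      (selected_rows P d :&: selected_rows P e)|)%:Z)%Z.
    by rewrite card_selected_rows3 !(rpredD, rpredN, rpredB).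
  by rewrite dvdzE.
rewrite /rows_sum dot_suml.
(* A row of P_d :&: P_e has product 1 with [s] exactly when it lies in P_s, so the sum is the
   cardinality mod 2. *)
transitivity (#|selected_rows P s :&:
    (selected_rows P d :&: selected_rows P e)|%:R : 'F_2).
  rewrite -sum1_card natr_sum (eq_bigl _ _ (fun i => finset.in_setI i _ _)).
  rewrite big_mkcondl /=; apply: eq_bigr => i _; rewrite inE.
  by case: eqP => [//|/eqP]; rewrite F2_eq1 negbK => /eqP.
by case/dvdnP: even3 => q ->; rewrite natrM (pchar_Zp (isT : 1 < 2)%N) mulr0.
Qed.

End Walsh.

(** * Almost sure events for random bit strings *)

Section RandomBits.
Variables (R : realType) (n : nat) (d : measure_display) (T : measurableType d).
Variables (Pr : probability T R) (Z : {RV Pr >-> bits n}).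

Lemma measurable_RV_bits (A : set (bits n)) : measurable (Z @^-1` A).
Proof. by rewrite -[_ @^-1` _]setTI; apply: measurable_funP. Qed.

(** Reduces probability one to point masses, the form in which the laws of [X] and [Y] are given. As
    [bits n] is finite, the complementary event is a finite disjoint union of fibres. *)
Lemma prob_bits_ae (A : set (bits n)) :
  Pr (Z @^-1` A) = 1%E <-> forall x, ~ A x -> Pr [set w | Z w = x] = 0%E.
Proof.
have -> : Pr (Z @^-1` A) = 1%E <-> Pr (Z @^-1` (~` A)) = 0%E.
  rewrite -preimage_setC probability_setC; last exact: measurable_RV_bits.
  have : Pr (Z @^-1` A) \is a fin_num by exact: fin_num_measure (measurable_RV_bits _).
  move=> /fineK <-; split=> [->|]; first by rewrite subee.
  by rewrite -EFinB => -[] /eqP; rewrite subr_eq0 => /eqP <-.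
split=> [PrA0 x nAx|PrA0].
  apply/eqP; rewrite -measure_le0 -PrA0; apply: le_measure; rewrite ?inE.
  - exact: (measurable_RV_bits [set x]).
  - exact: measurable_RV_bits.
  - by move=> w /= ->.
have -> : Z @^-1` (~` A) = \bigcup_(x in ~` A) [set w | Z w = x].
  by apply/seteqP; split=> w; [exists (Z w) | move=> [x nAx Zw]; rewrite /= Zw].
rewrite measure_fin_bigcup.
- by apply: fsbig1 => x /PrA0.
- exact: finite_finset.
- by move=> x y _ _ [w [<- <-]].
- by move=> x _; exact: (measurable_RV_bits [set x]).
Qed.

End RandomBits.

Theorem mainTheorem16 (R : realType) (m n : nat) (P : 'M['F_2]_(m, n))
    (dX : measure_display) (TX : measurableType dX) (PrX : probability TX R)
    (X : {RV PrX >-> bits n})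
    (dY : measure_display) (TY : measurableType dY) (PrY : probability TY R)
    (Y : {RV PrY >-> bits n})
    (hX : forall x : bits n, PrX [set w | X w = x] = (probX R P x)%:E)
    (hY : forall y : bits n, PrY [set w | Y w = y] = (probY R P y)%:E)
    (s : bits n) :
  PrX [set w | dot (X w) s = 0] = 1%E -> PrY [set w | dot (Y w) s = 0] = 1%E.
Proof.
move=> /(prob_bits_ae X [set x | dot x s = 0]) PrX0.
have amp0 x : dot x s != 0 -> amplitude R P x = 0.
  move=> /eqP /PrX0; rewrite hX => -[] /eqP; rewrite sqrf_eq0 => /eqP.
  exact: ComplexField.Normc.eq0_normc.
apply/(prob_bits_ae Y [set y | dot y s = 0]) => y /= ys.
(* No pair (d, e) has row sum [y] when y.s is nonzero, so the mass of [y] is an empty sum. *)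
rewrite hY /probY big_pred0// => -[d e] /=.
apply/eqP => rows_y; apply: ys; rewrite -rows_y.
exact: (dot_rows_sum _ _ amp0).
Qed.
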